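(* Let $\mathrm{ZX}_{\mathsf{simp}}$ be the simplified stabilizer ZX-calculus described in the context. The rule (EU$'$), i.e. the equation $$H=R_Z^{(1,1)}(\tfrac\pi2)\circ R_X^{(2,1)}(0)\circ(R_Z^{(0,1)}(-\tfrac\pi2)\otimes1_1)\circ R_Z^{(1,1)}(\tfrac\pi2),$$ is necessary: $\mathrm{ZX}_{\mathsf{simp}}\setminus(\mathrm{EU'})\not\vdash(\mathrm{EU'})$. That is, this equation is not derivable from the remaining rules.
   Context: **Diagrams.** Diagrams $D:n\to m$ ($n,m\in\mathbb N$) are the morphisms of the free strict monoidal category with objects $\mathbb N$ (tensor on objects is addition) generated by: green spiders $R_Z^{(n,m)}(\alpha):n\to m$ and red spiders $R_X^{(n,m)}(\alpha):n\to m$ for all $n,m\in\mathbb N$ and $\alpha\in\{k\pi/2\mid k\in\mathbb Z\}$ (angles are real numbers, not taken modulo $2\pi$); $H:1\to1$; the swap $\sigma:2\to2$; the cup $\epsilon:2\to0$; the cap $\eta:0\to2$. The identity on $n$ is $1_n$, and $e=1_0$ is the empty diagram. $D_2\circ D_1$ means first $D_1$ then $D_2$; in $D_1\otimes D_2$, $D_1$ is on the left. Put $R_Z^{(n,m)}:=R_Z^{(n,m)}(0)$, $R_X^{(n,m)}:=R_X^{(n,m)}(0)$. **Only connectivity matters (meta rule).** $G_D=(V,E,\ell)$ has one vertex for each spider, each $H$, each input and each output of $D$, and one edge for each wire of $D$ (wires being followed through swaps, cups and caps), joining the vertices at its two ends. A green (red) spider of angle $\alpha$ is labelled $R_Z(\alpha)$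 ($R_X(\alpha)$), an $H$ is labelled $H$, the $j$-th input (output) from the left is labelled $I_j$ ($O_j$). The order and direction in which wires are attached to a spider or $H$ is not recorded. The meta rule: $D_1=D_2$ whenever there is a bijection of the vertices of $G_{D_1}$ and $G_{D_2}$ preserving labels and the number of edges between any two (possibly equal) vertices, and the two diagrams have the same number of closed wire loops carrying no vertex. **Calculus.** For a set $R$ of rules, $R\vdash D_1=D_2$ means that $(D_1,D_2)$ belongs to the smallest equivalence relation on parallel diagrams that is closed under $\circ$ and $\otimes$ and contains all equations in $R$. $\mathrm{ZX}_{\mathsf{simp}}$ consists of the meta rule above and of the following rules; $\mathrm{ZX}_{\mathsf{simp}}\setminus(\mathrm X)$ is obtained by deleting all instances of rule (X). - (S1) for all $a,b,c,d\ge0$, $k\ge1$ and all $\alpha,\beta$: $(1_b\otimes R_Z^{(k+c,d)}(\beta))\circ(R_Z^{(a,b+k)}(\alpha)\otimes1_c)=R_Z^{(a+c,b+d)}(\alpha+\beta)$ (ordinary addition of angles). - (S3$'$L) $\eta=R_Z^{(0,2)}$; (S3$'$R) $R_Z^{(0,2)}=R_X^{(0,2)}$. - (B1) $(R_Z^{(1,0)}\circ R_X^{(0,1)})\otimes(R_Z^{(1,2)}\circ R_X^{(0,1)})=R_X^{(0,1)}\otimes R_X^{(0,1)}$. - (B2$'$) $R_Z^{(0,0)}\otimes\big[(R_X^{(2,1)}\otimes R_X^{(2,1)})\circ(1_1\otimes\sigma\otimes1_1)\circ(R_Z^{(1,2)}\otimes R_Z^{(1,2)})\big]=(R_Z^{(1,0)}\circ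 R_X^{(0,1)})\otimes(R_Z^{(1,2)}\circ R_X^{(2,1)})$. - (EU$'$) $H=R_Z^{(1,1)}(\tfrac\pi2)\circ R_X^{(2,1)}\circ(R_Z^{(0,1)}(-\tfrac\pi2)\otimes1_1)\circ R_Z^{(1,1)}(\tfrac\pi2)$. - (H) for all $n,m,\alpha$: $H^{\otimes m}\circ R_X^{(n,m)}(\alpha)\circ H^{\otimes n}=R_Z^{(n,m)}(\alpha)$. - (IV$'$) $R_Z^{(0,0)}\otimes(R_X^{(3,0)}\circ R_Z^{(0,3)})\otimes(R_X^{(3,0)}\circ R_Z^{(0,3)})=e$. - (ZO$'$) $R_Z^{(0,0)}(\pi)\otimes R_Z^{(0,1)}=R_Z^{(0,0)}(\pi)\otimes R_X^{(0,1)}$. *)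

(* Defs.v *)
From HB Require Import structures.
From mathcomp Require Import all_boot all_order all_algebra.
From mathcomp Require Import boolp reals trigo.

Set Implicit Arguments.
Unset Strict Implicit.
Unset Printing Implicit Defensive.

Import Order.TTheory GRing.Theory Num.Theory.

Declare Scope diagram_scope.
Delimit Scope diagram_scope with D.

Section Angles.
Local Open Scope ring_scope.
Variable R : realType.

Definition quarter_turn_angle : {pred R} :=
  fun a => `[< exists k : int, a = k%:~R * (pi / 2) >].

Lemma quarter_turn_angle_zmod_closed : zmod_closed quarter_turn_angle.
Proof.
split=> [|x y /asboolP[k ->] /asboolP[l ->]]; apply/asboolP.
  by exists 0; rewrite mul0r.
by exists (k - l); rewrite rmorphB mulrBl.
Qed.

HB.instance Definition _ :=
  GRing.isZmodClosed.Build R quarter_turn_angle quarter_turn_angle_zmod_closed.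

(* Angles are real numbers: 0 and 2 * pi are different angles. *)
Record angle := Angle { angle_val :> R; angleP : angle_val \in quarter_turn_angle }.

HB.instance Definition _ := [isSub for angle_val].
HB.instance Definition _ := [Choice of angle by <:].
HB.instance Definition _ := [SubChoice_isSubZmodule of angle by <:].

Lemma half_pi_subproof : pi / 2 \in quarter_turn_angle.
Proof. by apply/asboolP; exists 1; rewrite mul1r. Qed.

Lemma pi_subproof : pi \in quarter_turn_angle.
Proof. by apply/asboolP; exists 2; rewrite mulrC divfK // pnatr_eq0. Qed.

Definition half_pi_angle : angle := Angle half_pi_subproof.
Definition pi_angle : angle := Angle pi_subproof.

End Angles.

(* Terms for the morphisms of the free strict monoidal category; they are
   identified up to the axioms [monoidal_axiom] below. [D2 \o D1] is first
   [D1], then [D2]; [cup] has two inputs and [cap] has two outputs. *)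
Inductive diagram (R : realType) : nat -> nat -> Type :=
| RZ n m of angle R : diagram R n m
| RX n m of angle R : diagram R n m
| had : diagram R 1 1
| swap : diagram R 2 2
| cup : diagram R 2 0
| cap : diagram R 0 2
| idd n : diagram R n n
| dcomp n m p of diagram R m p & diagram R n m : diagram R n p
| dtens n1 m1 n2 m2 of diagram R n1 m1 & diagram R n2 m2 :
    diagram R (n1 + n2) (m1 + m2).

Arguments RZ {R} n m _%_R.
Arguments RX {R} n m _%_R.
Arguments had {R}.
Arguments swap {R}.
Arguments cup {R}.
Arguments cap {R}.
Arguments idd {R} n.
Bind Scope diagram_scope with diagram.

Reserved Notation "D1 \ox D2" (at level 40, left associativity).
Notation "D2 \o D1" := (dcomp D2 D1) : diagram_scope.
Notation "D1 \ox D2" := (dtens D1 D2) : diagram_scope.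
Local Open Scope diagram_scope.

Definition cast_diagram R n m n' m' (en : n = n') (em : m = m')
    (D : diagram R n m) : diagram R n' m' :=
  ecast k (diagram R k m') en (ecast k (diagram R n k) em D).

Fixpoint had_pow (R : realType) n : diagram R n n :=
  if n is n'.+1 then had \ox had_pow R n' else idd 0.

Inductive monoidal_axiom (R : realType) :
  forall n m, diagram R n m -> diagram R n m -> Prop :=
| comp_assoc n m p q (D1 : diagram R n m) (D2 : diagram R m p)
    (D3 : diagram R p q) :
    monoidal_axiom (D3 \o (D2 \o D1)) ((D3 \o D2) \o D1)
| comp_id_l n m (D : diagram R n m) : monoidal_axiom (idd m \o D) D
| comp_id_r n m (D : diagram R n m) : monoidal_axiom (D \o idd n) D
| tens_assoc n1 m1 n2 m2 n3 m3 (D1 : diagram R n1 m1) (D2 : diagram R n2 m2)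
    (D3 : diagram R n3 m3) :
    monoidal_axiom
      (cast_diagram (addnA n1 n2 n3) (addnA m1 m2 m3) (D1 \ox (D2 \ox D3)))
      ((D1 \ox D2) \ox D3)
| tens_unit_l n m (D : diagram R n m) : monoidal_axiom (idd 0 \ox D) D
| tens_unit_r n m (D : diagram R n m) :
    monoidal_axiom (cast_diagram (addn0 n) (addn0 m) (D \ox idd 0)) D
| tens_id n m : monoidal_axiom (idd n \ox idd m) (idd (n + m))
| interchange n1 m1 p1 n2 m2 p2
    (D1 : diagram R n1 m1) (E1 : diagram R m1 p1)
    (D2 : diagram R n2 m2) (E2 : diagram R m2 p2) :
    monoidal_axiom ((E1 \ox E2) \o (D1 \ox D2)) ((E1 \o D1) \ox (E2 \o D2)).

Inductive label (R : realType) : Type :=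
| LabelZ of angle R
| LabelX of angle R
| LabelH
| LabelI of nat
| LabelO of nat.

Arguments LabelH {R}.
Arguments LabelI {R} _.
Arguments LabelO {R} _.

(* A wire is a connected component of [point] under [joined]. The [node]s are
   the spiders and the H's; every [leg] of a node sits at a point, and so does
   every input and every output. Inputs and outputs become vertices only in
   [vertex] below, because they disappear when diagrams are composed. *)
Record open_graph (R : realType) (n m : nat) := OpenGraph {
  node : finType;
  node_label : node -> label R;
  leg : finType;
  leg_node : leg -> node;
  point : finType;
  joined : rel point;
  leg_point : leg -> point;
  in_point : 'I_n -> point;
  out_point : 'I_m -> point
}.

Definition node_graph R n m (l : label R) : open_graph R n m :=
  @OpenGraph R n m
    unit (fun=> l)
    ('I_n + 'I_m)%type (fun=> tt)
    ('I_n + 'I_m)%type (fun _ _ => false) id inl inr.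

(* The graph of a diagram without nodes, whose wires are the elements of [P]. *)
Definition wire_graph R n m (P : finType) (i : 'I_n -> P) (o : 'I_m -> P) :
    open_graph R n m :=
  @OpenGraph R n m
    void (fun v => match v with end)
    void (fun l => match l with end)
    P (fun _ _ => false) (fun l => match l with end) i o.

Definition sum_case A B C (f : A -> C) (g : B -> C) (x : A + B) : C :=
  match x with inl a => f a | inr b => g b end.

Definition sum_map A B C D (f : A -> C) (g : B -> D) : A + B -> C + D :=
  sum_case (inl \o f)%FUN (inr \o g)%FUN.

Definition comp_graph R n m p (G2 : open_graph R m p) (G1 : open_graph R n m) :
    open_graph R n p :=
  let glued (x : point G1) (y : point G2) :=
    [exists j, (out_point G1 j == x) && (in_point G2 j == y)] in
  @OpenGraph R n p
    (node G1 + node G2)%type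
    (sum_case (@node_label _ _ _ G1) (@node_label _ _ _ G2))
    (leg G1 + leg G2)%type
    (sum_map (@leg_node _ _ _ G1) (@leg_node _ _ _ G2))
    (point G1 + point G2)%type
    (fun x y => match x, y with
     | inl x, inl y => joined x y
     | inr x, inr y => joined x y
     | inl x, inr y => glued x y
     | inr x, inl y => glued y x
     end)
    (sum_map (@leg_point _ _ _ G1) (@leg_point _ _ _ G2))
    (inl \o @in_point _ _ _ G1)%FUN
    (inr \o @out_point _ _ _ G2)%FUN.

Definition tens_graph R n1 m1 n2 m2
    (G1 : open_graph R n1 m1) (G2 : open_graph R n2 m2) :
    open_graph R (n1 + n2) (m1 + m2) :=
  @OpenGraph R (n1 + n2) (m1 + m2)
    (node G1 + node G2)%type
    (sum_case (@node_label _ _ _ G1) (@node_label _ _ _ G2))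
    (leg G1 + leg G2)%type
    (sum_map (@leg_node _ _ _ G1) (@leg_node _ _ _ G2))
    (point G1 + point G2)%type
    (fun x y => match x, y with
     | inl x, inl y => joined x y
     | inr x, inr y => joined x y
     | _, _ => false
     end)
    (sum_map (@leg_point _ _ _ G1) (@leg_point _ _ _ G2))
    (sum_map (@in_point _ _ _ G1) (@in_point _ _ _ G2) \o @split n1 n2)%FUN
    (sum_map (@out_point _ _ _ G1) (@out_point _ _ _ G2) \o @split m1 m2)%FUN.

Fixpoint graph R n m (D : diagram R n m) : open_graph R n m :=
  match D with
  | RZ n m a => node_graph n m (LabelZ a)
  | RX n m a => node_graph n m (LabelX a)
  | had => node_graph 1 1 LabelH
  | swap => wire_graph R id (@rev_ord 2)
  | cup => wire_graph R (fun=> tt) (fun j : 'I_0 => tt)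
  | cap => wire_graph R (fun i : 'I_0 => tt) (fun=> tt)
  | idd n => wire_graph R (@id 'I_n) id
  | D2 \o D1 => comp_graph (graph D2) (graph D1)
  | D1 \ox D2 => tens_graph (graph D1) (graph D2)
  end.

Section MetaRule.
Variables (R : realType) (n m : nat).
Implicit Type G : open_graph R n m.

Definition vertex G : finType := (node G + ('I_n + 'I_m))%type.

Definition vertex_label G (v : vertex G) : label R :=
  match v with
  | inl v => node_label v
  | inr (inl i) => LabelI i
  | inr (inr j) => LabelO j
  end.

Definition wire_end G : finType := (leg G + ('I_n + 'I_m))%type.

Definition end_vertex G : wire_end G -> vertex G := sum_map (@leg_node _ _ _ G) id.

Definition end_point G : wire_end G -> point G :=
  sum_case (@leg_point _ _ _ G)
    (sum_case (@in_point _ _ _ G) (@out_point _ _ _ G)).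

(* A wire that is not a closed loop is represented by the set of its two ends. *)
Definition nb_edges G (u v : vertex G) : nat :=
  #|[set w : {set wire_end G} |
      [exists e, exists e',
        [&& e != e', connect (@joined _ _ _ G) (end_point e) (end_point e'),
            w == [set e; e'], end_vertex e == u & end_vertex e' == v]]]|.

Definition nb_loops G : nat :=
  n_comp (@joined _ _ _ G)
    [pred x | [forall e : wire_end G,
                 ~~ connect (@joined _ _ _ G) x (end_point e)]].

Definition same_connectivity (D1 D2 : diagram R n m) : Prop :=
  (exists f : vertex (graph D1) -> vertex (graph D2),
    [/\ bijective f,
        forall v, vertex_label (f v) = vertex_label v
      & forall u v, nb_edges (f u) (f v) = nb_edges u v])
  /\ nb_loops (graph D1) = nb_loops (graph D2).

End MetaRule.

(* A prime in the name of a rule is written [p]. *)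
Inductive rule_name :=
  Meta | S1 | S3pL | S3pR | B1 | B2p | EUp | Hcol | IVp | ZOp.

Definition EUp_rhs (R : realType) : diagram R 1 1 :=
  RZ 1 1 (half_pi_angle R) \o RX 2 1 0
    \o (RZ 0 1 (- half_pi_angle R) \ox idd 1) \o RZ 1 1 (half_pi_angle R).

Inductive rule_instance (R : realType) :
  rule_name -> forall n m, diagram R n m -> diagram R n m -> Prop :=
| meta_rule n m (D1 D2 : diagram R n m) :
    same_connectivity D1 D2 -> rule_instance Meta D1 D2
| S1_rule a b c d k (x y : angle R) : 0 < k ->
    rule_instance S1
      ((idd b \ox RZ (k + c) d y)
         \o cast_diagram erefl (esym (addnA b k c)) (RZ a (b + k) x \ox idd c))
      (RZ (a + c) (b + d) (x + y))
| S3pL_rule : rule_instance S3pL cap (RZ 0 2 0)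
| S3pR_rule : rule_instance S3pR (RZ 0 2 0) (RX 0 2 0)
| B1_rule :
    rule_instance B1
      ((RZ 1 0 0 \o RX 0 1 0) \ox (RZ 1 2 0 \o RX 0 1 0))
      (RX 0 1 0 \ox RX 0 1 0)
| B2p_rule :
    rule_instance B2p
      (RZ 0 0 0 \ox
        ((RX 2 1 0 \ox RX 2 1 0) \o (idd 1 \ox swap \ox idd 1)
           \o (RZ 1 2 0 \ox RZ 1 2 0)))
      ((RZ 1 0 0 \o RX 0 1 0) \ox (RZ 1 2 0 \o RX 2 1 0))
| EUp_rule : rule_instance EUp had (EUp_rhs R)
| Hcol_rule n m (x : angle R) :
    rule_instance Hcol (had_pow R m \o RX n m x \o had_pow R n) (RZ n m x)
| IVp_rule :
    rule_instance IVp
      (RZ 0 0 0 \ox (RX 3 0 0 \o RZ 0 3 0) \ox (RX 3 0 0 \o RZ 0 3 0))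
      (idd 0)
| ZOp_rule :
    rule_instance ZOp
      (RZ 0 0 (pi_angle R) \ox RZ 0 1 0) (RZ 0 0 (pi_angle R) \ox RX 0 1 0).

Definition rule_set (R : realType) :=
  forall n m, diagram R n m -> diagram R n m -> Prop.

Definition ZXsimp (R : realType) : rule_set R :=
  fun n m D1 D2 => exists r, rule_instance r D1 D2.

Definition ZXsimp_without (R : realType) (X : rule_name) : rule_set R :=
  fun n m D1 D2 => exists2 r, r <> X & rule_instance r D1 D2.

Inductive derivable (R : realType) (Rs : rule_set R) :
  forall n m, diagram R n m -> diagram R n m -> Prop :=
| der_monoidal n m (D1 D2 : diagram R n m) :
    monoidal_axiom D1 D2 -> derivable Rs D1 D2
| der_rule n m (D1 D2 : diagram R n m) : Rs n m D1 D2 -> derivable Rs D1 D2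
| der_refl n m (D : diagram R n m) : derivable Rs D D
| der_sym n m (D1 D2 : diagram R n m) : derivable Rs D1 D2 -> derivable Rs D2 D1
| der_trans n m (D1 D2 D3 : diagram R n m) :
    derivable Rs D1 D2 -> derivable Rs D2 D3 -> derivable Rs D1 D3
| der_comp n m p (D1 D1' : diagram R n m) (D2 D2' : diagram R m p) :
    derivable Rs D1 D1' -> derivable Rs D2 D2' ->
    derivable Rs (D2 \o D1) (D2' \o D1')
| der_tens n1 m1 n2 m2 (D1 D1' : diagram R n1 m1) (D2 D2' : diagram R n2 m2) :
    derivable Rs D1 D1' -> derivable Rs D2 D2' ->
    derivable Rs (D1 \ox D2) (D1' \ox D2').

(* Main.v *)
(** The sum of the angles of all spiders of a diagram, which are real numbers
    and not taken modulo [2 * pi], is preserved by every rule other than (EU'),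
    whereas the two sides of (EU') have sums [0] and [pi / 2]. *)
Require Import Defs.
From mathcomp Require Import all_boot all_order all_algebra.
From mathcomp Require Import reals.
From mathcomp Require Import trigo.

Set Implicit Arguments.
Unset Strict Implicit.
Unset Printing Implicit Defensive.

Import Order.TTheory GRing.Theory Num.Theory.
Local Open Scope ring_scope.

Local Arguments cast_diagram : simpl never.

Section AngleSum.
Variable R : realType.

Definition label_angle (l : label R) : R :=
  match l with LabelZ a | LabelX a => a | _ => 0 end.

Fixpoint angle_sum n m (D : diagram R n m) : R :=
  match D with
  | RZ _ _ a | RX _ _ a => a
  | dcomp _ _ _ D2 D1 | dtens _ _ _ _ D1 D2 => angle_sum D1 + angle_sum D2
  | _ => 0
  end.

(** The meta rule compares graphs and ignores how diagrams are built, so the sum is expressed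
    through vertex labels, which it preserves. *)
Lemma angle_sum_vertices n m (D : diagram R n m) :
  angle_sum D = \sum_(v : vertex (graph D)) label_angle (vertex_label v).
Proof.
(* Inputs and outputs carry angle 0, so only the nodes remain, and these behave additively under
   both compositions. *)
rewrite big_sumType [X in _ = _ + X]big1 ?addr0 /=; last by move=> [].
elim: D => {n m} [n m a|n m a||||||n m p D2 IH2 D1 IH1|
    n1 m1 n2 m2 D1 IH1 D2 IH2] /=;
  try by rewrite (big_pred1 tt) // => -[].
- by rewrite big1 // => -[].
- by rewrite big1 // => -[].
- by rewrite big1 // => -[].
- by rewrite big1 // => -[].
- by rewrite big_sumType /= IH1 IH2.
- by rewrite big_sumType /= IH1 IH2.
Qed.

Lemma same_connectivity_angle_sum n m (D1 D2 : diagram R n m) :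
  same_connectivity D1 D2 -> angle_sum D1 = angle_sum D2.
Proof.
move=> [[f [f_bij f_label _]] _]; rewrite !angle_sum_vertices.
rewrite [RHS](reindex f) /=; last exact: onW_bij.
by apply: eq_bigr => v _; rewrite f_label.
Qed.

Lemma angle_sum_cast n m n' m' (en : n = n') (em : m = m')
    (D : diagram R n m) : angle_sum (cast_diagram en em D) = angle_sum D.
Proof. by case: n' / en; case: m' / em. Qed.

Lemma angle_sum_had_pow n : angle_sum (had_pow R n) = 0.
Proof. by elim: n => //= n ->; rewrite addr0. Qed.

(** Diagrams are only terms; this makes the sum well defined on morphisms of the free strict
    monoidal category. *)
Lemma monoidal_axiom_angle_sum n m (D1 D2 : diagram R n m) :
  monoidal_axiom D1 D2 -> angle_sum D1 = angle_sum D2.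
Proof.
case=> *; rewrite ?angle_sum_cast /= ?addr0 ?add0r //.
- exact/esym/addrA.
- exact: addrA.
- exact: addrACA.
Qed.

(** [S1] adds angles as real numbers, [Hcol] changes colour but not angle, and [ZOp] has pi on both
    sides; [S3pL], [S3pR], [B1], [B2p] and [IVp] involve only zero angles. *)
Lemma rule_instance_angle_sum r n m (D1 D2 : diagram R n m) :
  rule_instance r D1 D2 -> r <> EUp -> angle_sum D1 = angle_sum D2.
Proof.
case=> [k l E1 E2 /same_connectivity_angle_sum //|a b c d k x y _ _|_|_|_|_|//
    |k l x _|_|_] /=;
  by rewrite ?angle_sum_cast ?angle_sum_had_pow /= ?addr0 ?add0r.
Qed.

Lemma derivable_angle_sum n m (D1 D2 : diagram R n m) :
  derivable (@ZXsimp_without R EUp) D1 D2 -> angle_sum D1 = angle_sum D2.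
Proof.
elim=> {n m D1 D2} /=.
- by move=> n m D1 D2 /monoidal_axiom_angle_sum.
- by move=> n m D1 D2 [r r_neq /rule_instance_angle_sum ->].
- by [].
- by [].
- by move=> n m D1 D2 D3 _ -> _ ->.
- by move=> n m p D1 D1' D2 D2' _ -> _ ->.
- by move=> n1 m1 n2 m2 D1 D1' D2 D2' _ -> _ ->.
Qed.

Lemma angle_sum_EUp_rhs : angle_sum (EUp_rhs R) = pi / 2.
(* The green spiders contribute pi/2 - pi/2 + pi/2, the red one 0. *)
Proof. by rewrite /= addr0 add0r addrA; exact: subrK. Qed.

End AngleSum.

Theorem lemma3p4 (R : realType) :
  ~ derivable (@ZXsimp_without R EUp) had (EUp_rhs R).
Proof.
move=> /derivable_angle_sum; rewrite angle_sum_EUp_rhs /= => /esym/eqP.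
by rewrite mulf_eq0 invr_eq0 pnatr_eq0 orbF gt_eqF ?pi_gt0.
Qed.
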